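(* Every existentially closed valued difference field $(K,v,\sigma)$ is not existentially closed as a difference field, i.e. the difference field $(K,\sigma)$ obtained by forgetting the valuation is not existentially closed in the category of difference fields.
   Context: A difference field is a field with a (surjective) automorphism $\sigma$; difference fields are structures in the language of fields expanded by $\sigma,\sigma^{-1}$. A valued difference field $(K,v,\sigma)$ is a valued field with surjective valuation $v\colon K\to\Gamma\cup\{\infty\}$ (the trivial valuation is allowed), valuation ring $\mathcal O$, residue field $k$, residue map $\operatorname{res}$, together with a (surjective) field automorphism $\sigma$ of $K$ with $\sigma(\mathcal O)=\mathcal O$; $\sigma$ induces automorphisms of $\Gamma$ and $k$, also denoted $\sigma$. Valued difference fields are three-sorted structures (sorts $\mathrm{VF}$, $\Gamma$ including $\infty$, $k$) with field operations including $(-)^{-1}$ ($0^{-1}=0$) on $\mathrm{VF}$ and $k$; $+,0,-,<,\infty$ on $\Gamma$; $v$ and $\operatorname{res}$ (equal to $0$ outside $\mathcal O$); and $\sigma,\sigma^{-1}$ on each sort. Embeddings are embeddings of structures. An object $M$ of one of these categories is existentially closed in it if, for every embedding $f\colon M\to N$ in the category, every tuple $a$ from $M$, and every parameter-free quantifier-free formula $\phi(x,y)$ in the corresponding language, $N\models\exists x\,\phi(x,f(a))$ implies $M\models\exists x\,\phi(x,a)$. *)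

(* Defs.v *)
From HB Require Import structures.
From mathcomp Require Import all_boot all_order all_algebra.

Set Implicit Arguments.
Unset Strict Implicit.
Unset Printing Implicit Defensive.

Import Order.TTheory GRing.Theory Num.Theory.
Local Open Scope ring_scope.

Record diffField := DiffField {
  df_sort :> fieldType;
  sigma : {rmorphism df_sort -> df_sort};
  sigmaV : df_sort -> df_sort;
  sigmaK : cancel sigma sigmaV;
  sigmaVK : cancel sigmaV sigma }.

Arguments sigma {d}.
Arguments sigmaV {d}.

(* Preservation of 0, 1, +, - and * is the rmorphism structure. *)
Record df_embedding (M N : diffField) := DfEmbedding {
  df_map :> {rmorphism M -> N};
  df_map_inj : injective df_map;
  df_map_inv : forall x, df_map x^-1 = (df_map x)^-1;
  df_map_sigma : forall x, df_map (sigma x) = sigma (df_map x);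
  df_map_sigmaV : forall x, df_map (sigmaV x) = sigmaV (df_map x) }.

Inductive df_term (X : Type) : Type :=
| DVar of X
| DZero
| DOne
| DAdd of df_term X & df_term X
| DOpp of df_term X
| DMul of df_term X & df_term X
| DInv of df_term X
| DSigma of df_term X
| DSigmaV of df_term X.

Inductive df_formula (X : Type) : Type :=
| DFalse
| DEq of df_term X & df_term X
| DNot of df_formula X
| DAnd of df_formula X & df_formula X
| DOr of df_formula X & df_formula X.

Fixpoint df_eval (M : diffField) (X : Type) (e : X -> M) (t : df_term X) : M :=
  match t with
  | DVar x => e x
  | DZero => 0
  | DOne => 1
  | DAdd t1 t2 => df_eval e t1 + df_eval e t2
  | DOpp t1 => - df_eval e t1
  | DMul t1 t2 => df_eval e t1 * df_eval e t2
  | DInv t1 => (df_eval e t1)^-1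
  | DSigma t1 => sigma (df_eval e t1)
  | DSigmaV t1 => sigmaV (df_eval e t1)
  end.

Fixpoint df_holds (M : diffField) (X : Type) (e : X -> M) (phi : df_formula X)
    : Prop :=
  match phi with
  | DFalse => False
  | DEq t1 t2 => df_eval e t1 = df_eval e t2
  | DNot phi1 => ~ df_holds e phi1
  | DAnd phi1 phi2 => df_holds e phi1 /\ df_holds e phi2
  | DOr phi1 phi2 => df_holds e phi1 \/ df_holds e phi2
  end.

Definition join_env (X Y T : Type) (b : X -> T) (a : Y -> T) (z : X + Y) : T :=
  match z with inl x => b x | inr y => a y end.

(* In phi, the variables inl i are the tuple x and the inr j the tuple y. *)
Definition df_existentially_closed (M : diffField) : Prop :=
  forall (N : diffField) (f : df_embedding M N) (n m : nat)
         (a : 'I_m -> M) (phi : df_formula ('I_n + 'I_m)),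
    (exists b : 'I_n -> N, df_holds (join_env b (fun j => f (a j))) phi) ->
    exists b : 'I_n -> M, df_holds (join_env b a) phi.

(* The value group G extended by infinity is [option G]; infinity is [None]. *)

(* A [porderZmodType] has no axiom relating its order to its addition. *)
Definition ordered_abelian_group (G : porderZmodType) : Prop :=
  total (<=%R : rel G) /\
  (forall x y z : G, x <= y -> z + x <= z + y).

Section Infinity.
Variable G : porderZmodType.
Implicit Types g h : option G.

Definition zeroG : option G := Some 0.

Definition addG g h : option G :=
  match g, h with Some x, Some y => Some (x + y) | _, _ => None end.

(* - oo is set to oo *)
Definition oppG g : option G :=
  match g with Some x => Some (- x) | None => None end.

Definition ltG g h : bool :=
  match g, h with
  | Some x, Some y => x < y
  | Some _, None => true
  | None, _ => false
  end.

Definition leG g h : bool := (g == h) || ltG g h.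

Definition minG g h : option G := if ltG g h then g else h.

End Infinity.

Arguments zeroG {G}.

Record valDiffField := ValDiffField {
  VF :> diffField;
  VG : porderZmodType;
  RF : fieldType;
  val : VF -> option VG;
  res : VF -> RF;
  VG_ordered : ordered_abelian_group VG;
  val_eq_oo : forall x, val x = None <-> x = 0;
  valM : forall x y, val (x * y) = addG (val x) (val y);
  valD : forall x y, leG (minG (val x) (val y)) (val (x + y));
  val_surj : forall g, exists x, val x = g;
  (* (RF, res) is the residue field of the valuation ring, with res extended
     by 0 outside the valuation ring *)
  res1 : res 1 = 1;
  resD : forall x y, leG zeroG (val x) -> leG zeroG (val y) ->
         res (x + y) = res x + res y;
  resM : forall x y, leG zeroG (val x) -> leG zeroG (val y) ->
         res (x * y) = res x * res y;
  res_eq0 : forall x, leG zeroG (val x) -> (res x = 0 <-> ltG zeroG (val x));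
  res_surj : forall a, exists x, leG zeroG (val x) /\ res x = a;
  res_out : forall x, ~~ leG zeroG (val x) -> res x = 0;
  sigma_valring : forall y,
    leG zeroG (val y) <-> exists x, leG zeroG (val x) /\ sigma x = y }.

Arguments val {v}.
Arguments res {v}.

Section Induced.
Variable M : valDiffField.
Implicit Types (x y : M) (g : option (VG M)) (a : RF M).

Definition valring x : bool := leG zeroG (val x).

Lemma val_surjb g : exists x, val x == g.
Proof. by have [x <-] := val_surj g; exists x. Qed.

Lemma res_surjb a : exists x, valring x && (res x == a).
Proof.
by have [x [Ox <-]] := res_surj a; exists x; rewrite /valring Ox eqxx.
Qed.

Definition val_lift g : M := xchoose (val_surjb g).
Definition res_lift a : M := xchoose (res_surjb a).

(* The maps induced by sigma and its inverse on the other two sorts; their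
   independence of the chosen lifts is [sigmaG_val], ..., [sigmaVR_res]. *)
Definition sigmaG g : option (VG M) := val (sigma (val_lift g)).
Definition sigmaVG g : option (VG M) := val (sigmaV (val_lift g)).
Definition sigmaR a : RF M := res (sigma (res_lift a)).
Definition sigmaVR a : RF M := res (sigmaV (res_lift a)).

End Induced.

Section InducedTheory.
Variable M : valDiffField.
Implicit Types (x y : M) (g : option (VG M)) (a : RF M).

Lemma val_liftK g : val (val_lift g) = g.
Proof. exact/eqP/(xchooseP (val_surjb g)). Qed.

Lemma valring_lift a : valring (res_lift a).
Proof. by case/andP: (xchooseP (res_surjb a)). Qed.

Lemma res_liftK a : res (res_lift a) = a.
Proof. by apply/eqP; case/andP: (xchooseP (res_surjb a)). Qed.

Lemma valring_sigma x : valring (sigma x) = valring x.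
Proof.
apply/idP/idP; last by move=> Ox; apply/sigma_valring; exists x.
by case/sigma_valring=> y [Oy /(can_inj (@sigmaK M)) <-].
Qed.

Lemma valring_sigmaV x : valring (sigmaV x) = valring x.
Proof. by rewrite -valring_sigma sigmaVK. Qed.

Lemma sigmaVB : {morph @sigmaV M : x y / x - y}.
Proof.
by move=> x y; apply: (can_inj (@sigmaK M)); rewrite rmorphB !sigmaVK.
Qed.

Lemma sigmaVM : {morph @sigmaV M : x y / x * y}.
Proof.
by move=> x y; apply: (can_inj (@sigmaK M)); rewrite rmorphM !sigmaVK.
Qed.

Lemma sigmaV0 : sigmaV (0 : M) = 0.
Proof. by have := sigmaVB 0 0; rewrite !subrr. Qed.

Lemma sigmaV1 : sigmaV (1 : M) = 1.
Proof. by rewrite -[RHS]sigmaK rmorph1. Qed.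

Lemma leG_anti (g h : option (VG M)) : leG g h -> leG h g -> g = h.
Proof.
rewrite /leG => /predU1P[-> //|gh] /predU1P[-> //|].
by case: g h gh => [g|] [h|] //= gh /(lt_trans gh); rewrite ltxx.
Qed.

Lemma leG_trans (h g k : option (VG M)) : leG g h -> leG h k -> leG g k.
Proof.
rewrite /leG => /predU1P[-> //|gh] /predU1P[<-|]; first by rewrite gh orbT.
case: g h k gh => [g|] [h|] [k|] //= gh.
by move=> /(lt_trans gh) ->; rewrite orbT.
Qed.

Lemma leG_add (g h k : option (VG M)) : leG g h -> leG (addG k g) (addG k h).
Proof.
rewrite /leG => /predU1P[-> |]; first by rewrite eqxx.
case: k g h => [k|] [g|] [h|] //= gh.
have [_ addl] := VG_ordered M.
have := addl _ _ k (ltW gh).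
by rewrite le_eqVlt => /orP[/eqP ->|->]; rewrite ?eqxx ?orbT.
Qed.

Lemma addG0 (g : option (VG M)) : addG g zeroG = g.
Proof. by case: g => [g|] //=; rewrite addr0. Qed.

Lemma val0 : val (0 : M) = None. Proof. exact/val_eq_oo. Qed.

Lemma val1 : val (1 : M) = zeroG.
Proof.
have v1 : val (1 : M) <> None by move/val_eq_oo/eqP; rewrite oner_eq0.
have := valM (1 : M) 1; rewrite mulr1.
case: (val (1 : M)) v1 => [u|] //= _ [uu].
by congr (Some _); apply: (addrI u); rewrite addr0 -uu.
Qed.

Lemma valN1 : val (-1 : M) = zeroG.
Proof.
have v1 : val (-1 : M) <> None.
  by move/val_eq_oo/eqP; rewrite oppr_eq0 oner_eq0.
have := valM (-1 : M) (-1); rewrite mulrNN mulr1 val1.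
have [tot addl] := VG_ordered M.
case: (val (-1 : M)) v1 => [u|] //= _ [uu].
have {}uu : u + u = 0 by [].
congr (Some _); apply/le_anti/andP.
have [h|h] := orP (tot u 0); split => //.
  by have := addl _ _ u h; rewrite uu addr0.
by have := addl _ _ u h; rewrite uu addr0.
Qed.

Lemma valN x : val (- x) = val x.
Proof.
by rewrite -mulN1r valM valN1; case: (val x) => [u|] //=; rewrite add0r.
Qed.

Lemma valringB x y : valring x -> valring y -> valring (x - y).
Proof.
rewrite /valring -(valN y) => Ox Oy; apply: leG_trans (valD _ _).
by rewrite /minG; case: ifP.
Qed.

Lemma valring_div x y : y != 0 -> val x = val y -> valring (x / y).
Proof.
by move=> y0 xy; rewrite /valring valM xy -valM divff // val1 /leG eqxx.
Qed.

Lemma val_congr (tau : M -> M) :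
    {morph tau : x y / x * y} -> (forall x, valring (tau x) = valring x) ->
    tau 0 = 0 ->
  forall x y, val x = val y -> val (tau x) = val (tau y).
Proof.
move=> tauM tauO tau0.
have le x y : y != 0 -> val x = val y -> leG (val (tau y)) (val (tau x)).
  move=> y0 xy; have := valring_div y0 xy; rewrite -tauO => Oxy.
  have -> : tau x = tau y * tau (x / y) by rewrite -tauM mulrCA divff // mulr1.
  by rewrite valM -[X in leG X]addG0; apply: leG_add.
move=> x y xy; have [x0|x0] := eqVneq x 0.
  by move: xy; rewrite x0 val0 => /esym/val_eq_oo ->.
have y0 : y != 0.
  by apply: contra_neq x0 => y0; apply/val_eq_oo; rewrite xy y0 val0.
by apply: leG_anti; apply: le.
Qed.

Lemma sigmaG_val x : sigmaG (val x) = val (sigma x).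
Proof.
apply: val_congr; rewrite ?rmorph0 ?val_liftK //; first exact: rmorphM.
exact: valring_sigma.
Qed.

Lemma sigmaVG_val x : sigmaVG (val x) = val (sigmaV x).
Proof.
apply: val_congr; rewrite ?val_liftK //.
- exact: sigmaVM.
- exact: valring_sigmaV.
- exact: sigmaV0.
Qed.

Lemma res_congr (tau : M -> M) :
    {morph tau : x y / x - y} ->
    (forall x, valring (tau x) = valring x) ->
    (forall x, val (tau x) = zeroG -> val x = zeroG) ->
  forall x y, valring x -> valring y ->
  res x = res y -> res (tau x) = res (tau y).
Proof.
move=> tauB tauO tau_unit x y Ox Oy xy.
have OB := valringB Ox Oy.
have r0 : res (x - y) = 0.
  by apply: (addIr (res y)); rewrite -resD // subrK add0r.
rewrite -[tau x](subrK (tau y)) -tauB resD -/(valring _) ?tauO //.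
suff -> : res (tau (x - y)) = 0 by rewrite add0r.
apply/res_eq0; first by rewrite -/(valring _) tauO.
move/res_eq0: r0 => /(_ OB) r0; have := OB; rewrite -tauO /valring /leG.
by case/predU1P => [/esym/tau_unit v0|//]; move: r0; rewrite v0 /= ltxx.
Qed.

Lemma sigmaR_res x : valring x -> sigmaR (res x) = res (sigma x).
Proof.
move=> Ox; apply: res_congr; rewrite ?res_liftK ?valring_lift //.
- exact: rmorphB.
- exact: valring_sigma.
- by move=> y; rewrite -{2}[y]sigmaK -sigmaVG_val => ->;
  rewrite -val1 sigmaVG_val sigmaV1.
Qed.

Lemma sigmaVR_res x : valring x -> sigmaVR (res x) = res (sigmaV x).
Proof.
move=> Ox; apply: res_congr; rewrite ?res_liftK ?valring_lift //.
- exact: sigmaVB.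
- exact: valring_sigmaV.
- by move=> y; rewrite -{2}[y]sigmaVK -sigmaG_val => ->;
  rewrite -val1 sigmaG_val rmorph1.
Qed.

End InducedTheory.

Record vdf_embedding (M N : valDiffField) := VdfEmbedding {
  vf_map : {rmorphism VF M -> VF N};
  vg_map : option (VG M) -> option (VG N);
  rf_map : {rmorphism RF M -> RF N};
  vf_map_inj : injective vf_map;
  vg_map_inj : injective vg_map;
  rf_map_inj : injective rf_map;
  vf_map_inv : forall x, vf_map x^-1 = (vf_map x)^-1;
  rf_map_inv : forall a, rf_map a^-1 = (rf_map a)^-1;
  vg_map_add : forall g h, vg_map (addG g h) = addG (vg_map g) (vg_map h);
  vg_map_zero : vg_map zeroG = zeroG;
  vg_map_opp : forall g, vg_map (oppG g) = oppG (vg_map g);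
  vg_map_oo : vg_map None = None;
  vg_map_lt : forall g h, ltG (vg_map g) (vg_map h) = ltG g h;
  map_val : forall x, vg_map (val x) = val (vf_map x);
  map_res : forall x, rf_map (res x) = res (vf_map x);
  vf_map_sigma : forall x, vf_map (sigma x) = sigma (vf_map x);
  vf_map_sigmaV : forall x, vf_map (sigmaV x) = sigmaV (vf_map x);
  vg_map_sigma : forall g, vg_map (sigmaG g) = sigmaG (vg_map g);
  vg_map_sigmaV : forall g, vg_map (sigmaVG g) = sigmaVG (vg_map g);
  rf_map_sigma : forall a, rf_map (sigmaR a) = sigmaR (rf_map a);
  rf_map_sigmaV : forall a, rf_map (sigmaVR a) = sigmaVR (rf_map a) }.

Inductive vdf_sort := SVF | SVG | SRF.

Definition vdf_carrier (M : valDiffField) (s : vdf_sort) : Type :=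
  match s with
  | SVF => VF M
  | SVG => option (VG M)
  | SRF => RF M
  end.

Definition vdf_map (M N : valDiffField) (f : vdf_embedding M N) (s : vdf_sort) :
    vdf_carrier M s -> vdf_carrier N s :=
  match s with
  | SVF => vf_map f
  | SVG => vg_map f
  | SRF => rf_map f
  end.

Inductive vdf_term (X : vdf_sort -> Type) : vdf_sort -> Type :=
| VVar s of X s : vdf_term X s
| FZero : vdf_term X SVF
| FOne : vdf_term X SVF
| FAdd of vdf_term X SVF & vdf_term X SVF : vdf_term X SVF
| FOpp of vdf_term X SVF : vdf_term X SVF
| FMul of vdf_term X SVF & vdf_term X SVF : vdf_term X SVF
| FInv of vdf_term X SVF : vdf_term X SVF
| FSigma of vdf_term X SVF : vdf_term X SVF
| FSigmaV of vdf_term X SVF : vdf_term X SVF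
| GZero : vdf_term X SVG
| GInfty : vdf_term X SVG
| GAdd of vdf_term X SVG & vdf_term X SVG : vdf_term X SVG
| GOpp of vdf_term X SVG : vdf_term X SVG
| GSigma of vdf_term X SVG : vdf_term X SVG
| GSigmaV of vdf_term X SVG : vdf_term X SVG
| GVal of vdf_term X SVF : vdf_term X SVG
| RZero : vdf_term X SRF
| ROne : vdf_term X SRF
| RAdd of vdf_term X SRF & vdf_term X SRF : vdf_term X SRF
| ROpp of vdf_term X SRF : vdf_term X SRF
| RMul of vdf_term X SRF & vdf_term X SRF : vdf_term X SRF
| RInv of vdf_term X SRF : vdf_term X SRF
| RSigma of vdf_term X SRF : vdf_term X SRF
| RSigmaV of vdf_term X SRF : vdf_term X SRF
| RRes of vdf_term X SVF : vdf_term X SRF.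

Inductive vdf_formula (X : vdf_sort -> Type) : Type :=
| VFalse
| VEq (s : vdf_sort) of vdf_term X s & vdf_term X s
| VLt of vdf_term X SVG & vdf_term X SVG
| VNot of vdf_formula X
| VAnd of vdf_formula X & vdf_formula X
| VOr of vdf_formula X & vdf_formula X.

Section Semantics.
Variables (M : valDiffField) (X : vdf_sort -> Type).
Variable e : forall s, X s -> vdf_carrier M s.

Fixpoint vdf_eval (s : vdf_sort) (t : vdf_term X s) : vdf_carrier M s :=
  match t in vdf_term _ s return vdf_carrier M s with
  | VVar _ x => e x
  | FZero => (0 : VF M)
  | FOne => (1 : VF M)
  | FAdd t1 t2 => (vdf_eval t1 : VF M) + (vdf_eval t2 : VF M)
  | FOpp t1 => - (vdf_eval t1 : VF M)
  | FMul t1 t2 => (vdf_eval t1 : VF M) * (vdf_eval t2 : VF M)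
  | FInv t1 => (vdf_eval t1 : VF M)^-1
  | FSigma t1 => sigma (vdf_eval t1 : VF M)
  | FSigmaV t1 => sigmaV (vdf_eval t1 : VF M)
  | GZero => (zeroG : option (VG M))
  | GInfty => (None : option (VG M))
  | GAdd t1 t2 =>
      addG (vdf_eval t1 : option (VG M)) (vdf_eval t2 : option (VG M))
  | GOpp t1 => oppG (vdf_eval t1 : option (VG M))
  | GSigma t1 => sigmaG (vdf_eval t1 : option (VG M))
  | GSigmaV t1 => sigmaVG (vdf_eval t1 : option (VG M))
  | GVal t1 => val (vdf_eval t1 : VF M)
  | RZero => (0 : RF M)
  | ROne => (1 : RF M)
  | RAdd t1 t2 => (vdf_eval t1 : RF M) + (vdf_eval t2 : RF M)
  | ROpp t1 => - (vdf_eval t1 : RF M)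
  | RMul t1 t2 => (vdf_eval t1 : RF M) * (vdf_eval t2 : RF M)
  | RInv t1 => (vdf_eval t1 : RF M)^-1
  | RSigma t1 => sigmaR (vdf_eval t1 : RF M)
  | RSigmaV t1 => sigmaVR (vdf_eval t1 : RF M)
  | RRes t1 => res (vdf_eval t1 : VF M)
  end.

Fixpoint vdf_holds (phi : vdf_formula X) : Prop :=
  match phi with
  | VFalse => False
  | VEq s t1 t2 => vdf_eval t1 = vdf_eval t2
  | VLt t1 t2 =>
      ltG (vdf_eval t1 : option (VG M)) (vdf_eval t2 : option (VG M))
  | VNot phi1 => ~ vdf_holds phi1
  | VAnd phi1 phi2 => vdf_holds phi1 /\ vdf_holds phi2
  | VOr phi1 phi2 => vdf_holds phi1 \/ vdf_holds phi2
  end.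

End Semantics.

(* A tuple of elements of the three sorts has n s entries of sort s. *)
Definition vdf_existentially_closed (M : valDiffField) : Prop :=
  forall (N : valDiffField) (f : vdf_embedding M N) (n m : vdf_sort -> nat)
         (a : forall s, 'I_(m s) -> vdf_carrier M s)
         (phi : vdf_formula (fun s => ('I_(n s) + 'I_(m s))%type)),
    (exists b : forall s, 'I_(n s) -> vdf_carrier N s,
      vdf_holds (fun s => join_env (b s) (fun j => vdf_map f (a s j))) phi) ->
    exists b : forall s, 'I_(n s) -> vdf_carrier M s,
      vdf_holds (fun s => join_env (b s) (a s)) phi.

(* Main.v *)
From HB Require Import structures.
From mathcomp Require Import all_boot all_order all_algebra qfpoly ring zify.
Require Import Defs.

Set Implicit Arguments.
Unset Strict Implicit.
Unset Printing Implicit Defensive.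

Import Order.TTheory GRing.Theory Num.Theory.
Import Pdiv.CommonRing Pdiv.RingMonic.
Local Open Scope ring_scope.

(** The proof compares two existence statements about elements x with
    sigma x = -1 - x. Such an x satisfies sigma (sigma x) = x, and x ^+ 2 + x
    is fixed by sigma, being minus the product of x and sigma x.

    In a valued difference field, an automorphism of the ordered value group
    whose square fixes a point fixes that point, so v(x) = v(sigma x) =
    v(x + 1); as 1 = (x + 1) - x, this common value is at most 0, and
    v(x ^+ 2 + x) = 2 v(x) <= 0 ([val_reflected]). If moreover sigma t = -1 - t
    and v(t) < 0, it follows that no a, b with sigma a = -1 - a and
    sigma b = -1 - b satisfy

      (a ^+ 2 + a) * (b ^+ 2 + b) * (t ^+ 2 + t) = 1,

    because the left side has negative value ([no_curve_point]).

    An existentially closed valued difference field contains such a t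
    ([vdf_ec_reflected]): extend sigma to the field of rational functions K(X)
    by sigma X = -1 - X, and compose the valuation at infinity of K(X) with the
    given valuation of its residue field K, so that v(X) < 0.

    On the other hand, once valuations are forgotten, a and b exist in a
    difference field extending K as soon as t ^+ 2 + t is nonzero
    ([curve_point_extension]): take a = X in K(X) as above, let h be the inverse of
    (a ^+ 2 + a) * (t ^+ 2 + t), and adjoin a root b of Y ^+ 2 + Y - h. This
    polynomial is irreducible over K(X) since h has a simple pole at 0 whereas
    a pole of c ^+ 2 + c has even order, and sigma extends by
    sigma b = -1 - b since -1 - b is the other root. Hence if K were
    existentially closed as a difference field too, a and b would exist in K. *)

(** * Difference fields and their embeddings *)

Section DiffFieldOfSurjection.
Variables (F : fieldType) (s : {rmorphism F -> F}).
Hypothesis s_surj : forall y, exists x, s x = y.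

Lemma surjb y : exists x, s x == y.
Proof. by have [x <-] := s_surj y; exists x. Qed.

Definition surj_inv y : F := xchoose (surjb y).

Lemma surj_invK : cancel surj_inv s.
Proof. by move=> y; apply/eqP/(xchooseP (surjb y)). Qed.

Lemma surjK : cancel s surj_inv.
Proof. by move=> x; apply: (fmorph_inj s); rewrite surj_invK. Qed.

Definition surj_diffField : diffField := DiffField surjK surj_invK.

End DiffFieldOfSurjection.

Section DfEmbedding.
Variables (D E : diffField) (f : {rmorphism D -> E}).
Hypothesis f_sigma : forall x, f (sigma x) = sigma (f x).

Lemma rmorph_sigmaV x : f (sigmaV x) = sigmaV (f x).
Proof.
by rewrite -[RHS](congr1 sigmaV (congr1 f (sigmaVK x))) f_sigma sigmaK.
Qed.

Definition rmorph_embedding : df_embedding D E :=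
  DfEmbedding (fmorph_inj f) (fmorphV f) f_sigma rmorph_sigmaV.

End DfEmbedding.

Section Composition.
Variables (D E N : diffField) (g : df_embedding E N) (f : df_embedding D E).

Lemma comp_sigma x :
  (df_map g \o df_map f) (sigma x) = sigma ((df_map g \o df_map f) x).
Proof. by rewrite /= !df_map_sigma. Qed.

Definition df_comp : df_embedding D N := rmorph_embedding comp_sigma.

End Composition.

(** * The reflection of the polynomial ring *)

Section Reflection.
Variable D : diffField.

(** Both extensions below, the fraction field of D[X] and its quotients by a
    quadratic polynomial, receive their automorphism from this one map, which
    sends X to -1 - X and extends sigma. *)
Definition refl_poly (p : {poly D}) : {poly D} :=
  map_poly sigma p \Po (-1 - 'X).

HB.instance Definition _ := GRing.RMorphism.copy refl_poly
  (comp_poly (-1 - 'X) \o map_poly (@sigma D)).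

Lemma refl_polyC c : refl_poly c%:P = (sigma c)%:P.
Proof. by rewrite /refl_poly map_polyC comp_polyC. Qed.

Lemma refl_polyX : refl_poly 'X = -1 - 'X.
Proof. by rewrite /refl_poly map_polyX comp_polyX. Qed.

Let size_reflX : size (-1 - 'X : {poly D}) = 2%N.
Proof. by rewrite -size_polyN opprD !opprK addrC size_XaddC. Qed.

Let lead_reflX : lead_coef (-1 - 'X : {poly D}) = -1.
Proof.
by rewrite -[LHS]opprK -lead_coefN opprD !opprK addrC lead_coefXaddC.
Qed.

Lemma size_refl_poly p : size (refl_poly p) = size p.
Proof. by rewrite size_comp_poly2 // size_map_poly. Qed.

Lemma refl_poly_eq0 p : (refl_poly p == 0) = (p == 0).
Proof. by rewrite -!size_poly_eq0 size_refl_poly. Qed.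

(** The coefficient is taken at an upper bound of the degree and not only at the
    degree itself, since numerators will be read off at the degree of their
    denominators. *)
Lemma coef_refl_poly (p : {poly D}) n : (size p <= n.+1)%N ->
  (refl_poly p)`_n = sigma p`_n * (-1) ^+ n.
Proof.
rewrite leq_eqVlt ltnS => /predU1P[sz|sz]; last first.
  by rewrite !nth_default ?size_refl_poly // rmorph0 mul0r.
have := lead_coef_comp (map_poly sigma p) (q := -1 - 'X).
rewrite size_reflX lead_coef_map lead_reflX size_map_poly => /(_ isT).
by rewrite /lead_coef -/(refl_poly p) size_refl_poly sz.
Qed.

Lemma refl_poly_surj q : exists p, refl_poly p = q.
Proof.
(* X |-> -1 - X is an involution. *)
have VX : (-1 - 'X) \Po (-1 - 'X) = 'X :> {poly D}.
  rewrite !rmorphB /= rmorphN1 /= comp_polyX; ring.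
exists (\poly_(i < size q) sigmaV (q \Po (-1 - 'X))`_i).
rewrite /refl_poly; set r := map_poly _ _.
suff -> : r = q \Po (-1 - 'X) by rewrite -comp_polyA VX comp_polyXr.
apply/polyP=> i; rewrite coef_map coef_poly; case: ltnP => [_|sz].
  exact: sigmaVK.
rewrite [RHS]nth_default; first exact: rmorph0.
by rewrite size_comp_poly2.
Qed.

End Reflection.

(** * Extension to the fraction field *)

Section Fractions.
Variable R : idomainType.
Implicit Types (x y : {fraction R}) (p q : R).

Local Notation "p %:F" := (@FracField.tofrac R p).

Definition numf x : R := \n_(repr x).
Definition denf x : R := \d_(repr x).

Lemma denf_neq0 x : denf x != 0.
Proof. exact: denom_ratioP. Qed.

Lemma denfF_neq0 x : (denf x)%:F != 0.
Proof. by rewrite tofrac_eq0 denf_neq0. Qed.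

Lemma fracE x : x = (numf x)%:F / (denf x)%:F.
Proof.
apply: (mulIf (denfF_neq0 x)); rewrite divfK ?denfF_neq0 //.
rewrite -{1}[x]reprK; unlock FracField.tofrac.
rewrite -[LHS]FracField.pi_mul; apply/eqmodP.
rewrite /= /equivf /FracField.mulf.
by rewrite !numden_Ratio ?mulf_neq0 ?oner_eq0 ?denom_ratioP //= !mulr1 mulrC.
Qed.

Lemma eq_frac p q p' q' : q != 0 -> q' != 0 ->
  (p%:F / q%:F == p'%:F / q'%:F) = (p * q' == p' * q).
Proof.
by move=> q0 q'0; rewrite eqr_div ?tofrac_eq0 // -!tofracM tofrac_eq.
Qed.

(** This cross product is all that is known of the chosen numerator and
    denominator; each notion defined from them is shown to depend only on it. *)
Lemma frac_spec p q : q != 0 ->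
  numf (p%:F / q%:F) * q = p * denf (p%:F / q%:F).
Proof.
by move=> q0; apply/eqP; rewrite eq_sym -eq_frac ?denf_neq0 // -fracE.
Qed.

Lemma fracD p q p' q' : q != 0 -> q' != 0 ->
  p%:F / q%:F + p'%:F / q'%:F = (p * q' + p' * q)%:F / (q * q')%:F.
Proof. by move=> q0 q'0; rewrite addf_div ?tofrac_eq0 // tofracD !tofracM. Qed.

Lemma fracM p q p' q' :
  p%:F / q%:F * (p'%:F / q'%:F) = (p * p')%:F / (q * q')%:F.
Proof. by rewrite mulf_div !tofracM. Qed.

End Fractions.

Section FracMap.
Variables (R : idomainType) (f : {rmorphism R -> R}).
Hypothesis f_eq0 : forall x, (f x == 0) = (x == 0).
Implicit Types (x y : {fraction R}) (p q : R).

Local Notation "p %:F" := (@FracField.tofrac R p).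

Definition frac_map x := (f (numf x))%:F / (f (denf x))%:F.

Lemma frac_mapE p q : q != 0 -> frac_map (p%:F / q%:F) = (f p)%:F / (f q)%:F.
Proof.
move=> q0; apply/eqP; rewrite eq_frac ?f_eq0 ?denf_neq0 //.
by rewrite -!rmorphM frac_spec.
Qed.

Lemma frac_map_tofrac p : frac_map p%:F = (f p)%:F.
Proof.
by have := frac_mapE p (oner_neq0 R); rewrite !rmorph1 !divr1.
Qed.

Lemma frac_map_is_zmod_morphism : zmod_morphism frac_map.
Proof.
move=> x y; rewrite {1}[x]fracE {1}[y]fracE -mulNr -tofracN.
have [dx dy] := (denf_neq0 x, denf_neq0 y).
rewrite fracD // frac_mapE ?mulf_neq0 // rmorphD !(rmorphM f) rmorphN.
by rewrite -fracD ?f_eq0 // tofracN mulNr.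
Qed.

Lemma frac_map_is_monoid_morphism : monoid_morphism frac_map.
Proof.
split=> [|x y]; first by rewrite -tofrac1 frac_map_tofrac rmorph1.
rewrite {1}[x]fracE {1}[y]fracE fracM frac_mapE ?mulf_neq0 ?denf_neq0 //.
by rewrite !(rmorphM f) -fracM.
Qed.

Definition frac_rmorph : {rmorphism {fraction R} -> {fraction R}} :=
  HB.pack frac_map
    (GRing.isZmodMorphism.Build _ _ frac_map frac_map_is_zmod_morphism)
    (GRing.isMonoidMorphism.Build _ _ frac_map frac_map_is_monoid_morphism).

Lemma frac_map_surj : (forall q, exists p, f p = q) ->
  forall y, exists x, frac_rmorph x = y.
Proof.
move=> f_surj y; have [n fn] := f_surj (numf y); have [d fd] := f_surj (denf y).
have d0 : d != 0 by rewrite -f_eq0 fd denf_neq0.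
by exists (n%:F / d%:F); rewrite /= frac_mapE // fn fd -fracE.
Qed.

End FracMap.

(** * The difference field of rational functions *)

(** The identity is proved over an abstract field because normalising a field
    expression in a concrete fraction field unfolds the quotient. *)
Lemma clear_denominator (F : fieldType) (P Q A : F) : Q != 0 ->
  ((P / Q) ^+ 2 + P / Q) * A = 1 -> (P ^+ 2 + P * Q) * A = Q ^+ 2.
Proof. by move=> Q0 E; rewrite -[RHS]mulr1 -E; field. Qed.

Section RationalFunctions.
Variable D : diffField.

Definition ratfun : diffField :=
  surj_diffField (frac_map_surj (@refl_poly_eq0 D) (@refl_poly_surj D)).

Definition ratC : {rmorphism D -> ratfun} :=
  @FracField.tofrac {poly D} \o @polyC D.

Definition ratX : ratfun := FracField.tofrac 'X.

Lemma ratC_sigma c : ratC (sigma c) = sigma (ratC c).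
Proof.
by rewrite /= -refl_polyC (frac_map_tofrac (@refl_poly_eq0 D)).
Qed.

Lemma ratX_sigma : sigma ratX = - 1 - ratX.
Proof.
rewrite /= (frac_map_tofrac (@refl_poly_eq0 D)) /= refl_polyX.
by rewrite rmorphB rmorphN1.
Qed.

(** The order of 0 as a root is even on the right; on the left it is odd if p
    has a smaller order than q, and too large otherwise. This is run as a
    descent: X divides q, then p, and the equation is the same for the quotients
    by X. *)
Lemma no_odd_pole (s : D) (p q : {poly D}) : s != 0 ->
  (p ^+ 2 + p * q) * (('X ^+ 2 + 'X) * s%:P) = q ^+ 2 -> q = 0.
Proof.
move=> s0; have [n] := ubnP (size q); elim: n p q => // n IHn p q szq E.
have X0 : 'X != 0 :> {poly D} by rewrite polyX_eq0.
have divX (r : {poly D}) : r.[0] = 0 -> exists r1, r = r1 * 'X.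
  by move/eqP/factor_theorem; rewrite subr0.
have [q1 qE] : exists q1, q = q1 * 'X.
  apply: divX; apply/eqP; have /(congr1 (horner^~ 0)) := E.
  by rewrite !hornerE /= mulr0 !mul0r => /esym/eqP; rewrite sqrf_eq0.
have E1 : (p ^+ 2 + p * (q1 * 'X)) * (('X + 1) * s%:P) = q1 ^+ 2 * 'X.
  by apply: (mulIf X0); rewrite -qE -[RHS]mulrA -expr2 -exprMn -qE -E; ring.
have [p1 pE] : exists p1, p = p1 * 'X.
  apply: divX; apply/eqP; have /(congr1 (horner^~ 0)) := E1.
  rewrite !hornerE /= mulr0 addr0 mulr1 => /eqP.
  by rewrite mulf_eq0 (negPf s0) orbF sqrf_eq0.
rewrite qE; have [->|q10] := eqVneq q1 0; first by rewrite mul0r.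
rewrite (IHn p1 q1) ?mul0r //.
  by move: szq; rewrite qE size_mulX // ltnS.
by apply: (mulIf X0); rewrite -E1 pE; ring.
Qed.

(** The hypothesis that drives the quadratic extension: the inverse of
    s (X ^+ 2 + X) has a simple pole at 0, so it is not of the form
    c ^+ 2 + c. The equation is multiplied out to keep that inverse out of the
    statement. *)
Lemma ratfun_no_root (s : D) (c : ratfun) :
  s != 0 -> (c ^+ 2 + c) * ((ratX ^+ 2 + ratX) * ratC s) != 1.
Proof.
move=> s0; apply/eqP; rewrite [c]fracE; have := denf_neq0 c.
move: (numf c) (denf c) => p q q0 E.
suff /(no_odd_pole s0) q_eq0 :
    (p ^+ 2 + p * q) * (('X ^+ 2 + 'X) * s%:P) = q ^+ 2.
  by rewrite q_eq0 eqxx in q0.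
apply/eqP; rewrite -tofrac_eq !(tofracM, tofracD, tofracXn); apply/eqP.
by apply: clear_denominator E; rewrite tofrac_eq0.
Qed.

Lemma ratX_quad_neq0 : ratX ^+ 2 + ratX != 0.
Proof.
rewrite /ratX -rmorphXn -rmorphD /= tofrac_eq0 -lead_coef_eq0.
by rewrite lead_coefDl ?lead_coefXn ?oner_eq0 // size_polyXn size_polyX.
Qed.

End RationalFunctions.

(** * Quadratic extensions *)

Section Quadratic.
Variables (D : diffField) (h : D).
Hypothesis sigma_h : sigma h = h.
Hypothesis no_root : forall c, c ^+ 2 + c != h.

Definition qpol : {poly D} := 'X^2 + 'X - h%:P.

Lemma size_qpol : size qpol = 3.
Proof.
rewrite /qpol -addrA size_polyDl size_polyXn //.
by rewrite size_XsubC.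
Qed.

Lemma qpol_monic : qpol \is monic.
Proof.
rewrite /qpol -addrA monicE lead_coefDl ?lead_coefXn //.
by rewrite size_XsubC size_polyXn.
Qed.

Lemma qpol_monic_irreducible : monic_irreducible_poly qpol.
Proof.
split; last exact: qpol_monic.
apply: cubic_irreducible; rewrite ?size_qpol // => c.
by rewrite /root /qpol !hornerE subr_eq0 no_root.
Qed.

Local Notation hI := qpol_monic_irreducible.
Definition quad : fieldType := {poly %/ qpol with hI}.

Definition quadP : {rmorphism {poly D} -> quad} := in_qpoly qpol.

Lemma quadP_val (q : quad) : quadP (\val q) = q.
Proof. exact/val_inj/in_qpoly_small/size_mk_monic. Qed.

Lemma quadP_eq0 p : quadP p = 0 <-> exists r, p = r * qpol.
Proof.
have valP : \val (quadP p) = rmodp p qpol by rewrite /= (mk_monicE hI).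
split=> [p0 | [r pE]].
  exists (rdivp p qpol); rewrite {1}(rdivp_eq qpol_monic p).
  by rewrite -valP p0 /= addr0.
by apply: val_inj; rewrite valP pE rmodp_mull // qpol_monic.
Qed.

Lemma refl_qpol : refl_poly qpol = qpol.
Proof.
rewrite /qpol rmorphB rmorphD rmorphXn /= refl_polyX refl_polyC sigma_h; ring.
Qed.

Definition quad_sigma (q : quad) : quad := quadP (refl_poly (\val q)).

(** The reflection maps the ideal of the quotient to itself because it fixes
    the quadratic polynomial: the roots have sum -1, and sigma fixes their
    product -h. *)
Lemma quad_sigmaP p : quad_sigma (quadP p) = quadP (refl_poly p).
Proof.
have [r rE] : exists r, \val (quadP p) - p = r * qpol.
  by apply/quadP_eq0; rewrite rmorphB quadP_val subrr.
apply/eqP; rewrite -subr_eq0 -!rmorphB rE rmorphM /= refl_qpol; apply/eqP.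
by apply/quadP_eq0; exists (refl_poly r).
Qed.

Lemma quad_sigma_is_zmod_morphism : zmod_morphism quad_sigma.
Proof.
move=> x y; rewrite -[x]quadP_val -[y]quadP_val -rmorphB !quad_sigmaP.
by rewrite !rmorphB.
Qed.

Lemma quad_sigma_is_monoid_morphism : monoid_morphism quad_sigma.
Proof.
split=> [|x y]; first by rewrite -(rmorph1 quadP) quad_sigmaP !rmorph1.
rewrite -[x]quadP_val -[y]quadP_val -rmorphM !quad_sigmaP.
by rewrite !rmorphM.
Qed.

Definition quad_rmorph : {rmorphism quad -> quad} :=
  HB.pack quad_sigma
    (GRing.isZmodMorphism.Build _ _ quad_sigma quad_sigma_is_zmod_morphism)
    (GRing.isMonoidMorphism.Build _ _ quad_sigma quad_sigma_is_monoid_morphism).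

Lemma quad_rmorph_surj y : exists x, quad_rmorph x = y.
Proof.
have [p Ep] := refl_poly_surj (\val y).
by exists (quadP p); rewrite [LHS]quad_sigmaP Ep quadP_val.
Qed.

Definition quadext : diffField := surj_diffField quad_rmorph_surj.

Definition quadC : {rmorphism D -> quadext} := quadP \o polyC.

Lemma quadC_sigma c : quadC (sigma c) = sigma (quadC c).
Proof. by rewrite [RHS]quad_sigmaP refl_polyC. Qed.

Definition quadX : quadext := quadP 'X.

Lemma quadX_sigma : sigma quadX = - 1 - quadX.
Proof. by rewrite [LHS]quad_sigmaP refl_polyX rmorphB rmorphN1. Qed.

Lemma quadXE : quadX ^+ 2 + quadX = quadC h.
Proof.
apply/eqP; rewrite -subr_eq0 -rmorphXn -rmorphD -rmorphB; apply/eqP/quadP_eq0.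
by exists 1; rewrite mul1r.
Qed.

End Quadratic.

Lemma quadratic_extension (D : diffField) (h : D) :
    sigma h = h -> (forall c, c ^+ 2 + c != h) ->
  exists (E : diffField) (f : df_embedding D E) (b : E),
    sigma b = -1 - b /\ b ^+ 2 + b = f h.
Proof.
move=> sh h_root.
exists (quadext sh h_root), (rmorph_embedding (quadC_sigma sh h_root)).
exists (quadX sh h_root); split; [exact: quadX_sigma | exact: quadXE].
Qed.

(** * A curve with points in difference field extensions *)

Lemma sigma_reflected (D : diffField) (x : D) : sigma x = -1 - x ->
  sigma (x ^+ 2 + x) = x ^+ 2 + x.
Proof. by move=> sx; rewrite rmorphD rmorphXn sx; ring. Qed.

Lemma curve_point_extension (D : diffField) (t : D) :
    sigma t = -1 - t -> t ^+ 2 + t != 0 ->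
  exists (N : diffField) (f : df_embedding D N) (a b : N),
    [/\ sigma a = -1 - a, sigma b = -1 - b &
        (a ^+ 2 + a) * (b ^+ 2 + b) * (f t ^+ 2 + f t) = 1].
Proof.
move=> st t0; pose K := ratfun D; pose a : K := ratX D.
pose h : K := ((a ^+ 2 + a) * ratC D (t ^+ 2 + t))^-1.
have sa : sigma a = -1 - a by exact: ratX_sigma.
have sh : sigma h = h.
  by rewrite /h fmorphV rmorphM -ratC_sigma !sigma_reflected.
have A0 : (a ^+ 2 + a) * ratC D (t ^+ 2 + t) != 0.
  by rewrite mulf_neq0 ?ratX_quad_neq0 ?fmorph_eq0.
have h_root c : c ^+ 2 + c != h.
  by have := ratfun_no_root c t0; apply: contraNneq => ->; rewrite mulVf.
have [N [g [b [sb bE]]]] := quadratic_extension sh h_root.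
pose f : df_embedding D K := rmorph_embedding (@ratC_sigma D).
exists N, (df_comp g f), (g a), b; split=> //.
  by rewrite -df_map_sigma sa rmorphB rmorphN1.
have -> : g a ^+ 2 + g a = g (a ^+ 2 + a) by rewrite rmorphD rmorphXn.
have -> : df_comp g f t ^+ 2 + df_comp g f t = g (ratC D (t ^+ 2 + t)).
  by rewrite !rmorphD !rmorphXn.
by rewrite bE mulrAC -!(rmorphM g) mulfV // rmorph1.
Qed.

Lemma df_ec_curve_point (D : diffField) (t : D) :
    df_existentially_closed D ->
    sigma t = -1 - t -> t ^+ 2 + t != 0 ->
  exists a b : D, [/\ sigma a = -1 - a, sigma b = -1 - b &
        (a ^+ 2 + a) * (b ^+ 2 + b) * (t ^+ 2 + t) = 1].
Proof.
move=> ec st t0; have [N [f [a [b [sa sb E]]]]] := curve_point_extension st t0.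
pose va : df_term ('I_2 + 'I_1) := DVar (inl 0).
pose vb : df_term ('I_2 + 'I_1) := DVar (inl 1).
pose vt : df_term ('I_2 + 'I_1) := DVar (inr 0).
pose refl_eq (x : df_term ('I_2 + 'I_1)) :=
  DEq (DSigma x) (DAdd (DOpp (DOne _)) (DOpp x)).
pose A (x : df_term ('I_2 + 'I_1)) := DAdd (DMul x x) x.
pose phi := DAnd (refl_eq va) (DAnd (refl_eq vb)
  (DEq (DMul (DMul (A va) (A vb)) (A vt)) (DOne _))).
have [|c /= [sc0 [sc1 Ec]]] := ec N f 2%N 1%N (fun=> t) phi.
  by exists (fun i => if i == 0 then a else b).
by exists (c 0), (c 1).
Qed.

(** * The curve has no points over a valued difference field *)

Section ExtendedGroup.
Variable G : porderZmodType.
Hypothesis oG : ordered_abelian_group G.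
Implicit Types g h k : option G.

Lemma leG_refl g : leG g g.
Proof. by rewrite /leG eqxx. Qed.

Lemma leG_Some (i j : G) : leG (Some i) (Some j) = (i <= j).
Proof. by rewrite /leG /= (inj_eq Some_inj) -le_eqVlt. Qed.

Lemma leG_total g h : leG g h || leG h g.
Proof. by case: g h => [i|] [j|] //=; rewrite !leG_Some; apply: oG.1. Qed.

Lemma ltG_leN g h : ltG g h -> leG h g -> False.
Proof.
case: g h => [i|] [j|] //=; rewrite leG_Some => ij.
by move=> /(lt_le_trans ij); rewrite ltxx.
Qed.

Lemma leG_addl g h k : leG g h -> leG (addG k g) (addG k h).
Proof.
by case: k g h => [k|] [g|] [h|] //; rewrite /= !leG_Some; apply: oG.2.
Qed.

Lemma leG_min g h k : (leG g h -> leG g k) -> (leG h g -> leG h k) ->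
  leG (minG g h) k.
Proof.
rewrite /minG => gk hk; case: ifP => [gh | ngh].
  by apply: gk; rewrite /leG gh orbT.
apply: hk; have /orP[|//] := leG_total g h; rewrite {1}/leG ngh orbF.
by move/eqP ->; apply: leG_refl.
Qed.

End ExtendedGroup.

Section ValuedFacts.
Variable M : valDiffField.
Implicit Types (x y : M) (g h : option (VG M)).

Lemma leG_div x y : x != 0 -> leG (val x) (val y) = valring (y / x).
Proof.
move=> x0; apply/idP/idP => [/(leG_add (val x^-1)) | /(leG_add (val x))].
  by rewrite -!valM mulVf // val1 mulrC.
by rewrite addG0 -valM mulrC divfK.
Qed.

Lemma leG_sigma x y : leG (val (sigma x)) (val (sigma y)) = leG (val x) (val y).
Proof.
have [->|x0] := eqVneq x 0; last first.
  by rewrite !leG_div ?fmorph_eq0 // -fmorphV -rmorphM valring_sigma.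
rewrite rmorph0 val0 /leG !orbF /=; apply/eqP/eqP => /esym/val_eq_oo/eqP.
  by rewrite fmorph_eq0 => /eqP ->; rewrite val0.
by move=> /eqP ->; rewrite rmorph0 val0.
Qed.

(** Since sigma preserves the order of values, v(x) <= v(sigma x) gives
    v(sigma x) <= v(sigma (sigma x)) = v(x), and likewise with the inequalities
    reversed. *)
Lemma val_sigma_invol x : sigma (sigma x) = x -> val (sigma x) = val x.
Proof.
move=> sxx; apply: leG_anti;
  have /orP[le|le] := leG_total (VG_ordered M) (val x) (val (sigma x)).
- by rewrite -{2}sxx leG_sigma.
- by [].
- by [].
- by rewrite -{1}sxx leG_sigma.
Qed.

(** As sigma x = -(x + 1), the elements x and x + 1 have the same value, which
    their difference 1 bounds from above. *)
Lemma val_reflected x : sigma x = -1 - x ->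
  leG (val x) zeroG /\ val (x ^+ 2 + x) = addG (val x) (val x).
Proof.
move=> sx.
have v1 : val (x + 1) = val x.
  rewrite -(val_sigma_invol (x := x)) ?sx; first by rewrite -valN opprD addrC.
  by rewrite rmorphB rmorphN1 sx; ring.
split; last by rewrite -v1 {2}v1 -valM; congr val; ring.
have -> : zeroG = val ((x + 1) + (- x)) by rewrite addrAC subrr add0r val1.
by apply: leG_trans (valD _ _); rewrite v1 valN /minG if_same leG_refl.
Qed.

Lemma leG_reflected x : sigma x = -1 - x -> leG (val (x ^+ 2 + x)) zeroG.
Proof.
move=> /val_reflected [le0 ->]; apply: (leG_trans _ le0).
by rewrite -[X in leG _ X]addG0; apply: leG_add.
Qed.

Lemma no_curve_point (t a b : M) : ltG (val t) zeroG ->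
    sigma t = -1 - t -> sigma a = -1 - a -> sigma b = -1 - b ->
  (a ^+ 2 + a) * (b ^+ 2 + b) * (t ^+ 2 + t) <> 1.
Proof.
move=> t_lt0 st sa sb E; apply: (ltG_leN t_lt0).
have addl c (u : option (VG M)) : sigma c = -1 - c ->
    leG (addG u (val (c ^+ 2 + c))) u.
  by move=> /leG_reflected c0; rewrite -[X in leG _ X]addG0; apply: leG_add.
have [t_le0 vt] := val_reflected st.
have /(congr1 val) := E; rewrite mulrC mulrA !valM val1 vt => <-.
apply: (leG_trans (addl _ _ sb)); apply: (leG_trans (addl _ _ sa)).
by rewrite -[X in leG _ X]addG0; apply: leG_add.
Qed.

Lemma reflected_neq0 (t : M) : ltG (val t) zeroG -> sigma t = -1 - t ->
  t ^+ 2 + t != 0.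
Proof.
move=> t_lt0 /val_reflected [_ vt]; apply: contraTneq t_lt0 => tt0.
by move: vt; rewrite tt0 val0; case: (val t).
Qed.

End ValuedFacts.

(** * The valuation of the rational function field *)

Definition lexZ (G : porderZmodType) : Type := int * G.

HB.instance Definition _ (G : porderZmodType) :=
  GRing.Zmodule.copy (lexZ G) (int * G)%type.
HB.instance Definition _ (G : porderZmodType) :=
  Order.POrder.copy (lexZ G) (int *lexi[ring_display] G).

Section LexZ.
Variable G : porderZmodType.

Lemma le_lexZ (x y : lexZ G) :
  (x <= y) = (x.1 <= y.1) && ((y.1 <= x.1) ==> (x.2 <= y.2)).
Proof. by []. Qed.

Lemma lexZ_ordered : ordered_abelian_group G ->
  ordered_abelian_group (lexZ G).
Proof.
move=> [tot addl]; split=> [[i g] [j h] | [i g] [j h] [k l]].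
  by rewrite !le_lexZ /=; case: (ltgtP i j) => //= _; exact: tot.
rewrite !le_lexZ /= !lerD2l.
by case: (ltgtP i j) => //= _ gh; apply: addl.
Qed.

End LexZ.

(** Unlike for leading coefficients, m and n only bound the degrees:
    coefficients at a common bound behave additively as well as
    multiplicatively. *)
Lemma coefM_top (R : idomainType) (p q : {poly R}) m n :
  (size p <= m.+1)%N -> (size q <= n.+1)%N -> (p * q)`_(m + n) = p`_m * q`_n.
Proof.
move=> szp szq; have [szpE|szpN] := eqVneq (size p) m.+1; last first.
  rewrite [p`_m]nth_default ?mul0r; last by rewrite -ltnS ltn_neqAle szpN.
  rewrite nth_default //; apply: leq_trans (size_polyMleq p q) _.
  by move: szp szq szpN; lia.
have [szqE|szqN] := eqVneq (size q) n.+1; last first.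
  rewrite [q`_n]nth_default ?mulr0; last by rewrite -ltnS ltn_neqAle szqN.
  rewrite nth_default //; apply: leq_trans (size_polyMleq p q) _.
  by move: szp szq szqN; lia.
have p0 : p != 0 by rewrite -size_poly_eq0 szpE.
have q0 : q != 0 by rewrite -size_poly_eq0 szqE.
have := lead_coefM p q; rewrite /lead_coef size_mul // szpE szqE /=.
by rewrite addnS.
Qed.

Section Place.
Variable D : diffField.
Implicit Types (x y : ratfun D) (p q : {poly D}).

Local Notation "p %:F" := (@FracField.tofrac {poly D} p).

(** Regularity at the point at infinity of the projective line. *)
Definition finite_inf x : bool := (size (numf x) <= size (denf x))%N.

(** The value at infinity, with 0 at a pole. When the denominator has the larger
    degree, the coefficient of the numerator that is read off is 0. *)
Definition place_inf x : D :=
  if finite_inf x then (numf x)`_(size (denf x)).-1 / lead_coef (denf x) else 0.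

Let size_cross (n q p d : {poly D}) :
  n * q = p * d -> d != 0 -> q != 0 -> n != 0 ->
  (size n + size q = size p + size d)%N.
Proof.
move=> E d0 q0 n0; have p0 : p != 0.
  by apply: contra_eqN E => /eqP ->; rewrite mul0r mulf_neq0.
have : (size (n * q)).+1 = (size (p * d)).+1 by rewrite E.
rewrite !size_mul //.
move: p0 q0 n0 d0; rewrite -!size_poly_gt0.
move: (size n) (size q) (size p) (size d) => ? ? ? ?; lia.
Qed.

Lemma finite_infE p q : q != 0 ->
  finite_inf (p%:F / q%:F) = (size p <= size q)%N.
Proof.
move=> q0; have := frac_spec p q0; have := denf_neq0 (p%:F / q%:F).
rewrite /finite_inf; move: (numf _) (denf _) => n d d0 E.
have [n0|n0] := eqVneq n 0; last first.
  have := size_cross E d0 q0 n0.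
  move: (size n) (size q) (size p) (size d) => ? ? ? ?; lia.
move/esym/eqP: E; rewrite n0 mul0r mulf_eq0 (negPf d0) orbF => /eqP ->.
by rewrite size_poly0.
Qed.

Lemma place_infE p q : q != 0 -> (size p <= size q)%N ->
  place_inf (p%:F / q%:F) = p`_(size q).-1 / lead_coef q.
Proof.
move=> q0 pq; rewrite /place_inf finite_infE // pq.
have := finite_infE p q0; rewrite pq /finite_inf.
have := frac_spec p q0; have := denf_neq0 (p%:F / q%:F).
move: (numf _) (denf _) => n d d0 E nd.
apply/eqP; rewrite eqr_div ?lead_coef_eq0 //; apply/eqP.
have szq : (size q = (size q).-1.+1) by rewrite prednK // size_poly_gt0.
have szd : (size d = (size d).-1.+1) by rewrite prednK // size_poly_gt0.
rewrite /lead_coef -coefM_top -?szq -?szd // E addnC.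
by rewrite coefM_top -?szq -?szd.
Qed.

Lemma place_infN x : ~~ finite_inf x -> place_inf x = 0.
Proof. by rewrite /place_inf => /negPf ->. Qed.

Lemma coefM_size (p q r s : {poly D}) : q != 0 -> s != 0 ->
    (size p <= size q)%N -> (size r <= size s)%N ->
  (size (p * r)%R <= size (q * s)%R)%N /\
  (p * r)`_(size (q * s)).-1 = p`_(size q).-1 * r`_(size s).-1.
Proof.
move=> q0 s0 pq rs; rewrite (size_mul q0 s0).
have szq : (size q = (size q).-1.+1) by rewrite prednK // size_poly_gt0.
have szs : (size s = (size s).-1.+1) by rewrite prednK // size_poly_gt0.
split.
  apply: leq_trans (size_polyMleq p r) _.
  move: pq rs szq szs; move: (size p) (size q) (size r) (size s); lia.
have -> : (size q + size s).-2 = ((size q).-1 + (size s).-1)%N.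
  by rewrite szq szs /= addnS.
by rewrite coefM_top -?szq -?szs.
Qed.

Lemma finite_infD x y : finite_inf x -> finite_inf y ->
  finite_inf (x + y) /\ place_inf (x + y) = place_inf x + place_inf y.
Proof.
rewrite [x]fracE [y]fracE; have := denf_neq0 x; have := denf_neq0 y.
move: (numf x) (denf x) (numf y) (denf y) => p q r s s0 q0.
rewrite fracD // !finite_infE ?mulf_neq0 // => pq rs.
have [szps ps] := coefM_size q0 s0 pq (leqnn _).
have [szrq rq] := coefM_size s0 q0 rs (leqnn _).
have sz : (size (p * s + r * q)%R <= size (q * s)%R)%N.
  apply: leq_trans (size_polyD _ _) _.
  by rewrite geq_max szps [in q * s]mulrC szrq.
split=> //; rewrite !place_infE ?mulf_neq0 //.
rewrite addf_div ?lead_coef_eq0 // lead_coefM coefD ps.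
by rewrite [in (q * s)]mulrC rq.
Qed.

Lemma finite_infM x y : finite_inf x -> finite_inf y ->
  finite_inf (x * y) /\ place_inf (x * y) = place_inf x * place_inf y.
Proof.
rewrite [x]fracE [y]fracE; have := denf_neq0 x; have := denf_neq0 y.
move: (numf x) (denf x) (numf y) (denf y) => p q r s s0 q0.
rewrite fracM // !finite_infE ?mulf_neq0 // => pq rs.
have [szpr pr] := coefM_size q0 s0 pq rs.
by split; rewrite // !place_infE ?mulf_neq0 // pr lead_coefM mulf_div.
Qed.

Lemma finite_inf_sigma x : finite_inf (sigma x) = finite_inf x.
Proof.
rewrite [in LHS](fracE x) [LHS]/= (frac_mapE (@refl_poly_eq0 D)) ?denf_neq0 //.
by rewrite finite_infE ?refl_poly_eq0 ?denf_neq0 // !size_refl_poly.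
Qed.

Lemma place_inf_sigma x : place_inf (sigma x) = sigma (place_inf x).
Proof.
have [fx|nfx] := boolP (finite_inf x); last first.
  by rewrite !place_infN ?rmorph0 // finite_inf_sigma.
have d0 := denf_neq0 x; rewrite [in LHS](fracE x).
rewrite [sigma _](frac_mapE (@refl_poly_eq0 D)) // [in RHS](fracE x).
rewrite !place_infE ?size_refl_poly ?refl_poly_eq0 //=.
have szd : (size (denf x) = (size (denf x)).-1.+1).
  by rewrite prednK // size_poly_gt0.
rewrite fmorph_div /lead_coef size_refl_poly.
rewrite !coef_refl_poly -?szd //.
by rewrite -mulf_div mulfV ?mulr1 // expf_neq0 // oppr_eq0 oner_eq0.
Qed.

Lemma finite_infC c : finite_inf (ratC D c) /\ place_inf (ratC D c) = c.
Proof.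
have -> : ratC D c = c%:P%:F / 1%:F by rewrite tofrac1 divr1.
rewrite finite_infE ?oner_neq0 // size_poly1 size_polyC leq_b1; split=> //.
rewrite place_infE ?oner_neq0 ?size_poly1 ?size_polyC ?leq_b1 //.
by rewrite coefC lead_coef1 divr1.
Qed.

End Place.
Section Valuation.
Variable M : valDiffField.
Implicit Types (x y : ratfun M) (p q : {poly M}).

Local Notation "p %:F" := (@FracField.tofrac {poly M} p).
Local Notation G := (lexZ (VG M)).

Lemma lex_ordered : ordered_abelian_group G.
Proof. exact/lexZ_ordered/VG_ordered. Qed.

(** The order of vanishing of p / q at infinity, refined by the value of its
    leading coefficient there. For q nonzero, the value [None] arises exactly
    for p = 0, as then the quotient of leading coefficients is 0. *)
Definition lex_val p q : option G :=
  omap (pair ((size q)%:Z - (size p)%:Z)) (val (lead_coef p / lead_coef q)).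

Definition ratval x : option G := lex_val (numf x) (denf x).

Lemma val_eq0 (c : M) : (val c == None) = (c == 0).
Proof. by apply/eqP/eqP => /val_eq_oo. Qed.

Lemma lex_valM p q r s : q != 0 -> s != 0 ->
  lex_val (p * r) (q * s) = addG (lex_val p q) (lex_val r s).
Proof.
move=> q0 s0; rewrite /lex_val !lead_coefM -mulf_div valM.
have [->|p0] := eqVneq p 0; first by rewrite lead_coef0 !mul0r val0.
have [->|r0] := eqVneq r 0.
  by rewrite lead_coef0 !mul0r val0; case: (val _).
case: (val _) (val _) => [g|] [h|] //=; congr (Some (_, _)).
rewrite !size_mul //; move: p0 q0 r0 s0; rewrite -!size_poly_gt0.
move: (size p) (size q) (size r) (size s) => /=; lia.
Qed.

Lemma lex_val_refl p : p != 0 -> lex_val p p = zeroG.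
Proof.
by move=> p0; rewrite /lex_val mulfV ?lead_coef_eq0 // val1 /= subrr.
Qed.

Lemma ratvalE p q : q != 0 -> ratval (p%:F / q%:F) = lex_val p q.
Proof.
move=> q0; have d0 := denf_neq0 (p%:F / q%:F); have := frac_spec p q0.
rewrite /ratval; move: (numf _) (denf _) d0 => n d d0 E.
have z (u : option G) : addG u zeroG = u.
  by case: u => [u|] //=; rewrite addr0.
rewrite -[LHS]z -(lex_val_refl q0) -lex_valM // E [d * q]mulrC.
by rewrite lex_valM // lex_val_refl // z.
Qed.

Lemma ratvalM x y : ratval (x * y) = addG (ratval x) (ratval y).
Proof.
rewrite [in LHS](fracE x) [in LHS](fracE y) fracM.
by rewrite ratvalE ?mulf_neq0 ?denf_neq0 // lex_valM ?denf_neq0.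
Qed.

Lemma ratval_eq_oo x : ratval x = None <-> x = 0.
Proof.
have d0 := denf_neq0 x; rewrite [in X in _ <-> X](fracE x) /ratval /lex_val.
have : (val (lead_coef (numf x) / lead_coef (denf x)) == None) = (numf x == 0).
  by rewrite val_eq0 mulf_eq0 invr_eq0 !lead_coef_eq0 (negPf d0) orbF.
case: (val _) => [g|] /= => /esym n0; split=> //.
  by move/eqP; rewrite mulf_eq0 invr_eq0 !tofrac_eq0 n0 (negPf d0).
by move/eqP: n0 => -> _; rewrite tofrac0 mul0r.
Qed.

Lemma leG0_pair (i : int) (u : option (VG M)) :
  leG (zeroG : option G) (omap (pair i) u) =
  (u == None) || (0 < i) || (i == 0) && leG zeroG u.
Proof.
case: u => [g|] //=; rewrite !leG_Some le_lexZ /=.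
by case: ltgtP.
Qed.

Lemma ltG0_pair (i : int) (u : option (VG M)) :
  ltG (zeroG : option G) (omap (pair i) u) =
  (u == None) || (0 < i) || (i == 0) && ltG zeroG u.
Proof.
case: u => [g|] //=; rewrite !lt_leAnge !le_lexZ /=.
by case: ltgtP.
Qed.

(** One argument serves for the valuation ring and for its maximal ideal: P and
    Q stand for the orders of the two value groups, both strict or both not. *)
Lemma ratval_place (P : rel (option (VG M))) (Q : rel (option G)) x :
    (forall i u, Q zeroG (omap (pair i) u) =
                 (u == None) || (0 < i) || (i == 0) && P zeroG u) ->
    P zeroG None ->
  Q zeroG (ratval x) = finite_inf x && P zeroG (val (place_inf x)).
Proof.
move=> QE P0; rewrite /ratval /lex_val QE /place_inf /finite_inf.
rewrite subr_eq0 subr_gt0.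
have d0 := denf_neq0 x; move: (numf x) (denf x) d0 => p q q0.
rewrite eqz_nat ltz_nat.
have [pq|pq|pq] := ltngtP (size p) (size q).
- rewrite orbT nth_default; last by rewrite -ltnS prednK // size_poly_gt0.
  by rewrite mul0r val0.
- rewrite !orbF val_eq0 mulf_eq0 invr_eq0 !lead_coef_eq0 (negPf q0) orbF.
  by apply: contraTF pq => /eqP ->; rewrite size_poly0.
by rewrite orbF -pq; case: eqP => [->|//]; rewrite P0.
Qed.

Lemma leG0_ratval x :
  leG zeroG (ratval x) = finite_inf x && valring (place_inf x).
Proof. exact/ratval_place/erefl/leG0_pair. Qed.

Lemma ltG0_ratval x :
  ltG zeroG (ratval x) = finite_inf x && ltG zeroG (val (place_inf x)).
Proof. exact/ratval_place/erefl/ltG0_pair. Qed.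

Lemma ratval1 : ratval 1 = zeroG.
Proof.
by rewrite -[1](divr1) -tofrac1 ratvalE ?lex_val_refl ?oner_neq0.
Qed.

(** The ultrametric inequality is closure of the valuation ring under addition,
    after division by the summand of least value; the valuation ring is closed
    under addition because it is the preimage of that of M under the place at
    infinity. *)
Lemma ratvalD x y : leG (minG (ratval x) (ratval y)) (ratval (x + y)).
Proof.
suff add_le u v : leG (ratval u) (ratval v) -> leG (ratval u) (ratval (u + v)).
  by apply: (leG_min lex_ordered) => [/add_le //| /add_le]; rewrite addrC.
have [->|u0] := eqVneq u 0; first by rewrite add0r.
move/(leG_addl lex_ordered (ratval u^-1)).
rewrite -!ratvalM mulVf // ratval1 leG0_ratval => /andP[fuv Ouv].
have : leG zeroG (ratval (1 + u^-1 * v)).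
  have := leG_refl (zeroG : option G).
  rewrite -{2}ratval1 leG0_ratval => /andP[f1 O1].
  have [f p] := finite_infD f1 fuv; rewrite leG0_ratval f p /=.
  rewrite -[place_inf (_ * _)]opprK; apply: valringB => //.
  by rewrite /valring valN.
move/(leG_addl lex_ordered (ratval u)).
rewrite -ratvalM mulrDr mulr1 mulVKf //.
by case: (ratval u) => [g|] //=; rewrite addr0.
Qed.

Lemma ratvalC c : ratval (ratC M c) = omap (pair 0) (val c).
Proof.
have -> : ratC M c = c%:P%:F / 1%:F by rewrite tofrac1 divr1.
rewrite ratvalE ?oner_neq0 // /lex_val lead_coefC lead_coef1 divr1 size_poly1.
by rewrite size_polyC; have [->|_] := eqVneq c 0; rewrite ?val0.
Qed.

Lemma ratvalX : ratval (ratX M) = Some (-1, 0).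
Proof.
have -> : ratX M = 'X%:F / 1%:F by rewrite tofrac1 divr1.
rewrite ratvalE ?oner_neq0 // /lex_val lead_coefX lead_coef1 divr1 val1.
by rewrite size_poly1 size_polyX.
Qed.

Lemma ratval_surj g : exists x, ratval x = g.
Proof.
case: g => [[i g]|]; last by exists 0; apply/ratval_eq_oo.
have [c cE] := val_surj (Some g).
have c0 : c != 0 by rewrite -val_eq0 cE.
(* One of the two exponents is 0, according to the sign of i. *)
exists ((c *: 'X^`|Num.max (- i) 0|)%:F / 'X^`|Num.max i 0|%:F).
rewrite ratvalE ?expf_neq0 ?polyX_eq0 // /lex_val lead_coefZ !lead_coefXn.
rewrite size_scale // !size_polyXn mulr1 divr1 cE /=; congr (Some (_, _)); lia.
Qed.

Definition ratres x : RF M := res (place_inf x).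

Lemma ratval_sigma x : leG zeroG (ratval (sigma x)) = leG zeroG (ratval x).
Proof.
by rewrite !leG0_ratval finite_inf_sigma place_inf_sigma valring_sigma.
Qed.

Definition ratvdf : valDiffField.
Proof.
apply: (@ValDiffField (ratfun M) G (RF M) ratval ratres lex_ordered
          ratval_eq_oo ratvalM ratvalD ratval_surj).
- rewrite /ratres; have := (finite_infC (1 : M)).2; rewrite rmorph1 => ->.
  exact: res1.
- move=> x y; rewrite !leG0_ratval => /andP[fx Ox] /andP[fy Oy].
  by rewrite /ratres (finite_infD fx fy).2 resD.
- move=> x y; rewrite !leG0_ratval => /andP[fx Ox] /andP[fy Oy].
  by rewrite /ratres (finite_infM fx fy).2 resM.
- move=> x; rewrite leG0_ratval ltG0_ratval => /andP[-> Ox].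
  exact: res_eq0.
- move=> a; exists (ratC M (res_lift a)).
  have [fa pa] := finite_infC (res_lift a).
  by rewrite leG0_ratval fa /ratres pa valring_lift res_liftK.
- move=> x; rewrite leG0_ratval negb_and /ratres => /orP[/place_infN ->|].
    by apply/res_eq0; rewrite val0.
  exact: res_out.
move=> y; split=> [Oy | [x [Ox <-]]]; last by rewrite ratval_sigma.
by exists (sigmaV y); rewrite sigmaVK -ratval_sigma sigmaVK.
Defined.

Definition vg_incl (g : option (VG M)) : option (VG ratvdf) := omap (pair 0) g.

Lemma val_ratC c : vg_incl (val c) = val (ratC M c : ratvdf).
Proof. by rewrite /= ratvalC. Qed.

Lemma res_ratC c : res c = res (ratC M c : ratvdf).
Proof. by rewrite /= /ratres (finite_infC c).2. Qed.

Lemma ratC_sigmaV c : ratC M (sigmaV c) = sigmaV (ratC M c).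
Proof. exact: (rmorph_sigmaV (@ratC_sigma M)). Qed.

Lemma vg_incl_sigma g : vg_incl (sigmaG g) = sigmaG (vg_incl g).
Proof.
have [c <-] := val_surj g.
by rewrite sigmaG_val !val_ratC sigmaG_val ratC_sigma.
Qed.

Lemma vg_incl_sigmaV g : vg_incl (sigmaVG g) = sigmaVG (vg_incl g).
Proof.
have [c <-] := val_surj g.
by rewrite sigmaVG_val !val_ratC sigmaVG_val ratC_sigmaV.
Qed.

Lemma valring_ratC c : valring (ratC M c : ratvdf) = valring c.
Proof.
by have [fc pc] := finite_infC c; rewrite /valring /= leG0_ratval fc pc.
Qed.

Lemma res_incl_sigma (a : RF M) : @sigmaR M a = @sigmaR ratvdf a.
Proof.
have [c [Oc <-]] := res_surj a.
rewrite sigmaR_res // [in RHS]res_ratC [RHS]sigmaR_res ?valring_ratC //.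
by rewrite -ratC_sigma -res_ratC.
Qed.

Lemma res_incl_sigmaV (a : RF M) : @sigmaVR M a = @sigmaVR ratvdf a.
Proof.
have [c [Oc <-]] := res_surj a.
rewrite sigmaVR_res // [in RHS]res_ratC [RHS]sigmaVR_res ?valring_ratC //.
by rewrite -ratC_sigmaV -res_ratC.
Qed.

Definition ratvdf_embedding : vdf_embedding M ratvdf.
Proof.
apply: (@VdfEmbedding M ratvdf (ratC M) vg_incl
          (idfun : {rmorphism RF M -> RF M})).
- exact: fmorph_inj.
- by move=> [g|] [h|] //= [->].
- by [].
- exact: fmorphV.
- by [].
- by move=> [g|] [h|].
- by [].
- by move=> [g|] //=; rewrite /vg_incl /=.
- by [].
- by move=> [g|] [h|] //=; rewrite !lt_leAnge !le_lexZ /= lexx.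
- exact: val_ratC.
- exact: res_ratC.
- exact: ratC_sigma.
- exact: ratC_sigmaV.
- exact: vg_incl_sigma.
- exact: vg_incl_sigmaV.
- exact: res_incl_sigma.
- exact: res_incl_sigmaV.
Defined.

End Valuation.

(** * Existentially closed valued difference fields *)

Lemma vdf_ec_reflected (M : valDiffField) : vdf_existentially_closed M ->
  exists t : M, sigma t = -1 - t /\ ltG (val t) zeroG.
Proof.
move=> ec.
pose n s := if s is SVF then 1%N else 0%N.
pose vt : vdf_term (fun s => ('I_(n s) + 'I_0)%type) SVF := @VVar _ SVF (inl 0).
pose phi := VAnd (VEq (FSigma vt) (FAdd (FOpp (FOne _)) (FOpp vt)))
                 (VLt (GVal vt) (GZero _)).
have a0 s : 'I_0 -> vdf_carrier M s by case.
have [|c [st t0]] := ec (ratvdf M) (ratvdf_embedding M) n (fun=> 0%N) a0 phi.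
  pose b (s : vdf_sort) : 'I_(n s) -> vdf_carrier (ratvdf M) s :=
    match s with SVF => fun=> ratX M | SVG => fun=> None | SRF => fun=> 0 end.
  exists b; split; first exact: ratX_sigma.
  by rewrite /= ratvalX.
by exists (c SVF 0).
Qed.

Theorem corollary2p27 (M : valDiffField) :
  vdf_existentially_closed M -> ~ df_existentially_closed (VF M).
Proof.
move=> /vdf_ec_reflected [t [st t_lt0]] df_ec.
have [a [b [sa sb E]]] := df_ec_curve_point df_ec st (reflected_neq0 t_lt0 st).
exact: no_curve_point t_lt0 st sa sb E.
Qed.
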